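(* The largest possible clique in an underlying graph of $n$ vertices has size $\Omega(\sqrt{n})$; that is, there is a constant $c>0$ such that for every positive even integer $n$ there exists a configuration of $n$ points whose underlying graph contains a clique with at least $c\sqrt{n}$ vertices.
   Context: A configuration of $n$ points ($n$ even) is a set of $n$ points in $\mathbb{R}^2$ in general position (no three collinear). A halving line of the configuration is a line through two of the points such that exactly $(n-2)/2$ of the remaining $n-2$ points lie on each side of it. The underlying graph of the configuration is the graph whose vertices are the $n$ points, two vertices being adjacent if and only if the line through the corresponding two points is a halving line. A clique is a set of pairwise adjacent vertices. *)

(* Defs.v *)
From HB Require Import structures.
From mathcomp Require Import all_boot all_order all_algebra.
From mathcomp Require Import boolp reals.

Set Implicit Arguments.
Unset Strict Implicit.
Unset Printing Implicit Defensive.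

Import Order.TTheory GRing.Theory Num.Theory.
Local Open Scope ring_scope.

Section Configurations.

Variable R : realType.

Implicit Types (x : 'rV[R]_2) (n : nat).

(* The line {x | normal . x = offset}; different records may describe the
   same line (proportional equations). *)
Record line := Line {
  normal : 'rV[R]_2;
  offset : R;
  normal_neq0 : normal != 0
}.

Definition line_form (l : line) x : R :=
  \sum_(k < 2) normal l 0 k * x 0 k - offset l.

Definition on_line (l : line) x : bool := line_form l x == 0.

Definition pos_side (l : line) x : bool := 0 < line_form l x.

Definition neg_side (l : line) x : bool := line_form l x < 0.

Definition collinear3 x y z : Prop :=
  exists l : line, [/\ on_line l x, on_line l y & on_line l z].

(* A set of n points in general position, labelled by 'I_n. Injectivity is
   not implied by the collinearity condition when n = 2. *)
Definition configuration n (p : 'I_n -> 'rV[R]_2) : Prop :=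
  injective p /\
  forall i j k : 'I_n, i != j -> i != k -> j != k ->
    ~ collinear3 (p i) (p j) (p k).

Definition halving_line n (p : 'I_n -> 'rV[R]_2) (l : line) : Prop :=
  [/\ exists i j : 'I_n, [/\ i != j, on_line l (p i) & on_line l (p j)],
      #|[set k | pos_side l (p k)]| = ((n - 2)./2)%N
    & #|[set k | neg_side l (p k)]| = ((n - 2)./2)%N].

Definition underlying_graph n (p : 'I_n -> 'rV[R]_2) : rel 'I_n :=
  fun i j => (i != j) &&
    `[< exists l : line,
          [/\ on_line l (p i), on_line l (p j) & halving_line p l] >].

End Configurations.

Definition clique (T : finType) (e : rel T) (K : {set T}) : Prop :=
  {in K &, forall x y, x != y -> e x y}.

(* Main.v *)
Require Import Defs.
From mathcomp Require Import all_boot all_order all_algebra.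
From mathcomp Require Import boolp reals.
From mathcomp Require Import zify ring.

Set Implicit Arguments.
Unset Strict Implicit.
Unset Printing Implicit Defensive.

Import Order.TTheory GRing.Theory Num.Theory.
Local Open Scope ring_scope.

(** The clique consists of m points (x_i, x_i^2) on a parabola with
    x_i = 2^(i+1).  The secant through the a-th and the b-th of them has slope
    x_a + x_b, so for a < b the slopes are ordered lexicographically by (b, a).
    It has the clique points strictly between its ends below it and all the
    others above it, so it is far from halving in general, and extra points
    have to balance all m(m-1)/2 secants at once.

    A point (X, s X) with |X| huge sees a secant only through its slope: it is
    above it exactly when (s - slope) X > 0.  For each pair i < j we add

    - a point far to the right with s = x_i + x_j - 1, which is above precisely
      the secants that precede (i, j) in the order of slopes;
    - a point far to the left with s = x_j, which is above precisely the secants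
      (a, b) with j <= b.

    These two lie on opposite sides of the secant (a, b), except when j = b and
    a < i < b, and then both are above it ([side_pair]).  Charge them to the
    clique point i.  A point i strictly between a and b counts -1 itself and
    +2 through the pair (i, b); a point outside [a, b] counts +1 and gets
    nothing.  So every clique point other than a and b contributes +1
    ([sum_side_corner]) and the imbalance is m - 2, the same for all secants.
    Points above all secants or below all of them, in suitable numbers, cancel
    it ([sum_side]) and bring the total to n.  Since this uses m^2 - m points
    for the pairs and at least m - 2 for the correction, it works for each
    m >= 1 with m^2 + m - 2 <= n, whence a clique of at least sqrt(n)/2 points.

    General position is obtained afterwards: all abscissas are distinct, and
    replacing y by y + e x^2 with a small e makes every orientation determinant
    nonzero while keeping the signs of those that were nonzero
    ([parabolic_perturbation]). *)

(** * Orientation determinants and lines *)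

(** Positive when r is above the line from p to q, for p left of q. *)
Definition orient (R : comNzRingType) (p q r : R * R) : R :=
  (q.1 - p.1) * (r.2 - p.2) - (r.1 - p.1) * (q.2 - p.2).

Section Lines.
Variable R : realType.
Implicit Types p q r : R * R.

Definition vec p : 'rV[R]_2 := \row_(k < 2) (if k == 0 then p.1 else p.2).

Definition joining_normal p q : 'rV[R]_2 := vec (p.2 - q.2, q.1 - p.1).

Lemma joining_normal_neq0 p q : p.1 != q.1 -> joining_normal p q != 0.
Proof.
apply: contra => /eqP/rowP/(_ 1); rewrite !mxE /= => /eqP.
by rewrite subr_eq0 eq_sym.
Qed.

Definition joining_line p q (hpq : p.1 != q.1) : line R :=
  Line (p.1 * (p.2 - q.2) + p.2 * (q.1 - p.1)) (joining_normal_neq0 hpq).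

Lemma line_form_vec (l : line R) p :
  line_form l (vec p) = normal l 0 0 * p.1 + normal l 0 1 * p.2 - offset l.
Proof.
rewrite /line_form !big_ord_recl big_ord0 addr0 !mxE /=.
by have -> : lift ord0 ord0 = 1 :> 'I_2 by apply/val_inj.
Qed.

Lemma line_form_joining p q (hpq : p.1 != q.1) r :
  line_form (joining_line hpq) (vec r) = orient p q r.
Proof. by rewrite line_form_vec /= !mxE /= /orient; ring. Qed.

Lemma vec_inj_fst p q : vec p = vec q -> p.1 = q.1.
Proof. by move/rowP/(_ 0); rewrite !mxE. Qed.

(** The vectors q - p and r - p are both orthogonal to the normal of the common
    line, so their determinant kills each coordinate of that nonzero vector. *)
Lemma collinear3_orient p q r :
  collinear3 (vec p) (vec q) (vec r) -> orient p q r = 0.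
Proof.
case=> l []; rewrite /on_line !line_form_vec => /eqP hp /eqP hq /eqP hr.
have := normal_neq0 l; move: (normal l) (offset l) hp hq hr => u o hp hq hr.
have hu0 : u 0 0 * orient p q r = 0.
  have -> : u 0 0 * orient p q r =
    (r.2 - p.2) * ((u 0 0 * q.1 + u 0 1 * q.2 - o) -
                   (u 0 0 * p.1 + u 0 1 * p.2 - o)) -
    (q.2 - p.2) * ((u 0 0 * r.1 + u 0 1 * r.2 - o) -
                   (u 0 0 * p.1 + u 0 1 * p.2 - o)) by rewrite /orient; ring.
  by rewrite hp hq hr !subrr !mulr0 subrr.
have hu1 : u 0 1 * orient p q r = 0.
  have -> : u 0 1 * orient p q r =
    (q.1 - p.1) * ((u 0 0 * r.1 + u 0 1 * r.2 - o) -
                   (u 0 0 * p.1 + u 0 1 * p.2 - o)) -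
    (r.1 - p.1) * ((u 0 0 * q.1 + u 0 1 * q.2 - o) -
                   (u 0 0 * p.1 + u 0 1 * p.2 - o)) by rewrite /orient; ring.
  by rewrite hp hq hr !subrr !mulr0 subrr.
move=> un0; apply/eqP; apply: contraNT un0 => on0; apply/eqP/rowP => k.
rewrite mxE; case: k => [[|[|//]] hk].
- have -> : Ordinal hk = 0 by apply/val_inj.
  by move/eqP: hu0; rewrite mulf_eq0 (negbTE on0) orbF => /eqP.
- have -> : Ordinal hk = 1 by apply/val_inj.
  by move/eqP: hu1; rewrite mulf_eq0 (negbTE on0) orbF => /eqP.
Qed.

End Lines.

(** * Reaching general position *)

Section Perturbation.
Variables (R : realFieldType) (T : finType) (z : T -> int * int).

Definition lift_parabola (e : R) (p : int * int) : R * R :=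
  (p.1%:~R, p.2%:~R + e * p.1%:~R ^+ 2).

(** The coefficient of e is the Vandermonde determinant of the three abscissas,
    which is why a quadratic lift is used: it vanishes on no triple of points
    with distinct abscissas. *)
Lemma orient_lift e (p q r : int * int) :
  orient (lift_parabola e p) (lift_parabola e q) (lift_parabola e r) =
  (orient p q r)%:~R +
    e * ((q.1 - p.1) * (r.1 - p.1) * (r.1 - q.1))%:~R.
Proof. by rewrite /orient /= !(rmorphM, rmorphB) /=; ring. Qed.

(** A zero determinant becomes e times a nonzero Vandermonde determinant; a
    nonzero one, being an integer, has absolute value at least 1 and survives if
    e is smaller than the inverse of all the Vandermonde determinants. *)
Lemma parabolic_perturbation : injective (fst \o z) ->
  exists e : R, forall a b c, a != b -> a != c -> b != c ->
    let o := orient (z a) (z b) (z c) in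
    let o' := orient (lift_parabola e (z a)) (lift_parabola e (z b))
                     (lift_parabola e (z c)) in
    o' != 0 /\ (o != 0 -> sgz o' = sgz o).
Proof.
move=> zI.
pose V a b c := ((z b).1 - (z a).1) * ((z c).1 - (z a).1) * ((z c).1 - (z b).1).
(* Any strict upper bound of all the |V a b c| will do. *)
pose S : int := 1 + \sum_a \sum_b \sum_c `|V a b c|.
have VS a b c : `|V a b c| < S.
  rewrite /S (bigD1 a) //= (bigD1 b) //= (bigD1 c) //=.
  set s1 := \sum_(_ | _) _; set s2 := \sum_(_ | _) _; set s3 := \sum_(_ | _) _.
  suff [h1 h2 h3] : [/\ 0 <= s1, 0 <= s2 & 0 <= s3] by lia.
  by split; do 3?[apply: sumr_ge0 => ? _]; rewrite ?normr_ge0.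
have S0 : 0 < S by apply: ltr_pwDl => //; do 3?[apply: sumr_ge0 => ? _].
(* Forget the value of S, which would otherwise be unfolded by rewriting. *)
move: S VS S0 => S VS S0.
have SR : (S%:~R : R) != 0 by rewrite intr_eq0 gt_eqF.
exists (S%:~R)^-1 => a b c ab ac bc /=.
set o := orient (z a) _ _.
have -> : orient (lift_parabola S%:~R^-1 (z a)) (lift_parabola S%:~R^-1 (z b))
    (lift_parabola S%:~R^-1 (z c)) = (o * S + V a b c)%:~R / S%:~R.
  rewrite orient_lift -/(V a b c) -/o; move: (V a b c) o => v w.
  by rewrite intrD intrM; field.
rewrite mulf_eq0 invr_eq0 (negbTE SR) orbF intr_eq0.
have -> : sgz ((o * S + V a b c)%:~R / S%:~R : R) = sgz (o * S + V a b c).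
  have Si : 0 < (S%:~R : R)^-1 by rewrite invr_gt0 ltr0z.
  by rewrite sgzM sgz_int (gtr0_sgz Si) mulr1.
have V0 : V a b c != 0.
  by rewrite !mulf_neq0 // subr_eq0 (inj_eq zI) eq_sym.
have := VS a b c; move: (V a b c) V0 => v v0 vS.
case: (ltgtP o 0) => [o0|o0|->].
- have : o * S + v < 0 by nia.
  by move=> h; rewrite lt_eqF // !ltr0_sgz.
- have : 0 < o * S + v by nia.
  by move=> h; rewrite gt_eqF // !gtr0_sgz.
by rewrite mul0r add0r.
Qed.

End Perturbation.

(** * From balanced signs to halving lines *)

Lemma balanced_signs (R : realDomainType) (I : finType) (s : I -> R) (i j : I) :
  i != j -> (forall k, (s k == 0) = (k == i) || (k == j)) ->
  \sum_k sgz (s k) = 0 ->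
  #|[set k | 0 < s k]| = ((#|I| - 2)./2)%N /\
  #|[set k | s k < 0]| = ((#|I| - 2)./2)%N.
Proof.
move=> ij s0 ssum.
have cardE (P : pred I) : #|[set k | P k]| = (\sum_k P k)%N.
  by rewrite -sum1dep_card big_mkcond; apply: eq_bigr => k _; case: (P k).
have hz : #|[set k | s k == 0]| = 2%N.
  have -> : [set k | s k == 0] = [set i; j].
    by apply/setP => k; rewrite !inE s0.
  by rewrite cards2 ij.
have hsum : (#|[set k | 0 < s k]%R| + #|[set k | s k < 0]%R| +
    #|[set k | s k == 0]%R|)%N = #|I|.
  rewrite !cardE -!big_split -sum1_card /=; apply: eq_bigr => k _.
  by case: (ltgtP (s k) 0).
have hdiff : (#|[set k | 0 < s k]%R|%:R = #|[set k | s k < 0]%R|%:R :> int)%R.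
  apply/eqP; rewrite -subr_eq0 -ssum !cardE !natr_sum -sumrB; apply/eqP; apply: eq_bigr => k _.
  by case: (sgzP (s k)).
by move: hz hsum hdiff; rewrite !natz; lia.
Qed.

Lemma underlying_graph_sym (R : realType) n (p : 'I_n -> 'rV[R]_2) :
  symmetric (underlying_graph p).
Proof.
move=> i j; rewrite /underlying_graph eq_sym; congr (_ && _).
by apply/asboolP/asboolP => -[l [? ? ?]]; exists l.
Qed.

(** The signed count of the points over a line is computed on integer points,
    where collinear triples are allowed as long as no line through two members
    of K meets a third point; the perturbation then gives general position
    without moving any point across those lines. *)
Lemma clique_of_balanced_orientations (R : realType) (T : finType)
    (z : T -> int * int) (K : {set T}) :
  injective (fst \o z) ->
  (forall a b t, a \in K -> b \in K -> (z a).1 < (z b).1 ->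
     t != a -> t != b -> orient (z a) (z b) (z t) != 0) ->
  (forall a b, a \in K -> b \in K -> (z a).1 < (z b).1 ->
     \sum_t sgz (orient (z a) (z b) (z t)) = 0) ->
  exists p : 'I_#|T| -> 'rV[R]_2, configuration p /\
    exists K' : {set 'I_#|T|}, clique (underlying_graph p) K' /\ #|K'| = #|K|.
Proof.
move=> zI zK sK.
have [e he] := @parabolic_perturbation R T z zI.
pose P i := lift_parabola e (z (enum_val (A := T) i)).
have P1I : injective (fst \o P).
  by move=> i j /= /intr_inj /zI /enum_val_inj.
have Porient i j k : i != j -> i != k -> j != k -> orient (P i) (P j) (P k) != 0.
  move=> ij ik jk.
  by have [] := he (enum_val i) (enum_val j) (enum_val k);
    rewrite ?(inj_eq enum_val_inj).
exists (fun i => vec (P i)); split.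
  split; first by move=> i j /vec_inj_fst; apply: P1I.
  move=> i j k ij ik jk /collinear3_orient/eqP.
  by rewrite (negbTE (Porient _ _ _ ij ik jk)).
exists [set i | enum_val i \in K]; split; last first.
  rewrite -[in RHS](on_card_preimset (f := @enum_val T T)) //.
  exact/onW_bij/enum_val_bij.
move=> i j; rewrite !inE => iK jK.
wlog ltij : i j iK jK / (z (enum_val i)).1 < (z (enum_val j)).1.
  move=> W ij; case: (ltgtP (z (enum_val i)).1 (z (enum_val j)).1) => h.
  - exact: W.
  - by rewrite underlying_graph_sym; apply: W => //; rewrite eq_sym.
  - by move/zI/enum_val_inj: h ij => ->; rewrite eqxx.
move=> ij; rewrite /underlying_graph ij; apply/asboolP.
have Pij : (P i).1 != (P j).1 by rewrite (inj_eq P1I).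
pose s k := orient (P i) (P j) (P k).
have s0 k : (s k == 0) = (k == i) || (k == j).
  have [->|ki] := eqVneq k i.
    by rewrite /s /orient !subrr mulr0 mul0r subrr eqxx.
  have [->|kj] := eqVneq k j.
    by rewrite /s /orient mulrC subrr eqxx.
  by apply/negbTE/Porient => //; rewrite eq_sym.
have ssum : \sum_k sgz (s k) = 0.
  rewrite -[RHS](sK _ _ iK jK ltij) (reindex (@enum_val T T)) /=; last first.
    exact/onW_bij/enum_val_bij.
  apply: eq_bigr => k _.
  have [ki|ki] := eqVneq k i.
    by rewrite ki /s /orient !subrr !mulr0 !mul0r subrr !sgz0.
  have [kj|kj] := eqVneq k j.
    by rewrite kj /s /orient [X in X - _]mulrC subrr [X in X - _]mulrC subrr !sgz0.
  have evI := inj_eq (@enum_val_inj T T).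
  have [|||_ -> //] := he (enum_val i) (enum_val j) (enum_val k); rewrite ?evI //.
  - by rewrite eq_sym.
  - by rewrite eq_sym.
  - by apply: zK; rewrite ?evI.
have [hpos hneg] := balanced_signs ij s0 ssum; rewrite card_ord in hpos hneg.
have form k : line_form (joining_line Pij) (vec (P k)) = s k.
  exact: line_form_joining.
have on_i : on_line (joining_line Pij) (vec (P i)).
  by rewrite /on_line form s0 eqxx.
have on_j : on_line (joining_line Pij) (vec (P j)).
  by rewrite /on_line form s0 eqxx orbT.
exists (joining_line Pij); split=> //; split.
- by exists i, j.
- by rewrite -hpos; apply: eq_card => k; rewrite !inE /pos_side form.
- by rewrite -hneg; apply: eq_card => k; rewrite !inE /neg_side form.
Qed.

(** * Points on the parabola and far away *)

Definition parabola_point (x : int) : int * int := (x, x ^+ 2).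

Definition far_point (right : bool) (s L : int) : int * int :=
  let X := if right then L else - L in (X, s * X).

Lemma sgz_orient_parabola (x y w : int) : x < y ->
  sgz (orient (parabola_point x) (parabola_point y) (parabola_point w)) =
  sgz (w - x) * sgz (w - y).
Proof.
move=> xy; have -> : orient (parabola_point x) (parabola_point y)
    (parabola_point w) = (y - x) * (w - x) * (w - y) by rewrite /orient /=; ring.
by rewrite !sgzM (gtr0_sgz (_ : 0 < y - x)) ?subr_gt0 // mul1r.
Qed.

(** At abscissa X the gap between the line of slope s through the origin and
    the secant of slope x + y is (s - (x + y)) X + x y; the first term dominates
    because s - (x + y) is a nonzero integer and |X| > x y. *)
Lemma sgz_orient_far (x y L s : int) (right : bool) :
  0 < x -> x < y -> x * y < L -> s != x + y ->
  sgz (orient (parabola_point x) (parabola_point y) (far_point right s L)) =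
  if right then sgz (s - (x + y)) else - sgz (s - (x + y)).
Proof.
move=> x0 xy xyL sxy; set X := if right then L else - L.
have -> : orient (parabola_point x) (parabola_point y) (far_point right s L) =
    (y - x) * ((s - (x + y)) * X + x * y) by rewrite /orient /= -/X; ring.
rewrite sgzM (gtr0_sgz (_ : 0 < y - x)) ?subr_gt0 // mul1r.
have : s - (x + y) != 0 by rewrite subr_eq0.
have xy0 : 0 < x * y by rewrite mulr_gt0 // (lt_trans x0).
rewrite /X; move: (s - _) (x * y) xyL xy0 => D q qL q0 D0.
case: (ltgtP D 0) D0 => // hD _; case: right {X}.
- by rewrite !ltr0_sgz //; nia.
- by rewrite (ltr0_sgz hD) opprK gtr0_sgz //; nia.
- by rewrite !gtr0_sgz //; nia.
- by rewrite (gtr0_sgz hD) ltr0_sgz //; nia.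
Qed.

(** Doubling abscissas make the slopes [node a + node b] distinct and ordered by
    the larger index first.  All of them are even, which leaves the odd integers
    as slopes lying strictly between two consecutive ones. *)
Definition node (i : nat) : int := 2 ^+ i.+1.

Lemma node_gt0 i : 0 < node i.
Proof. by rewrite exprn_gt0. Qed.

Lemma node_even i : node i = 2 * 2 ^+ i.
Proof. by rewrite /node exprS. Qed.

Lemma node_lt i j : (i < j)%N -> 2 * node i <= node j.
Proof. by move=> ij; rewrite -exprS; apply: ler_weXn2l. Qed.

Lemma node_inj : injective node.
Proof.
move=> i j ij; have := node_gt0 i.
case: (ltngtP i j) => // /node_lt; rewrite ij; have := node_gt0 j; lia.
Qed.

Lemma sum_diag_pairs (V : nmodType) m (F : 'I_m -> 'I_m -> V) :
  \sum_i \sum_j F i j =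
  \sum_i (F i i + \sum_(j < m | (i < j)%N) (F i j + F j i)).
Proof.
rewrite [RHS]big_split /=.
under [X in _ = _ + X]eq_bigr do rewrite big_split.
rewrite [X in _ = _ + X]big_split /=.
rewrite [X in _ = _ + (_ + X)](exchange_big_dep xpredT) //= -!big_split /=.
apply: eq_bigr => i _; rewrite (bigD1 i) //=; congr (_ + _).
rewrite (bigID (fun j : 'I_m => (i < j)%N)) /=; congr (_ + _);
  apply: eq_bigl => j; rewrite -val_eqE /=; lia.
Qed.

(** * The construction *)

Section Construction.
Variables m r B : nat.

(** A square of labels encodes the clique and both families of far points: the
    diagonal labels the clique, (i, j) with i < j the right point of the pair and
    (j, i) its left point.  The last r labels are the ballast: B points below
    all secants and r - B above them. *)
Definition label : finType := ('I_m * 'I_m + 'I_r)%type.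

(** Every secant has intercept - node a * node b, smaller in absolute value than
    the square; the rank makes the abscissas of the far points distinct. *)
Definition reach (t : label) : int := node m ^+ 2 + (enum_rank t)%:Z.

(** In the third case i is the larger index of the pair.  Slopes of secants are
    positive, so slope 0 is below them all on the right and above on the left. *)
Definition point (t : label) : int * int :=
  match t with
  | inl (i, j) =>
    if i == j then parabola_point (node i)
    else if (i < j)%N then far_point true (node i + node j - 1) (reach t)
    else far_point false (node i) (reach t)
  | inr k => far_point (k < B)%N 0 (reach t)
  end.

Definition corner (i : 'I_m) : label := inl (i, i).

Lemma point_corner i : point (corner i) = parabola_point (node i).
Proof. by rewrite /= eqxx. Qed.

Lemma corner_inj : injective corner.
Proof. by move=> i j []. Qed.

Lemma node_lt_reach i t : (i < m)%N -> node i < reach t.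
Proof.
move=> /node_lt; have := node_gt0 i; rewrite /reach; nia.
Qed.

Lemma mul_node_lt_reach i j t : (i < m)%N -> (j < m)%N -> node i * node j < reach t.
Proof.
move=> /node_lt hi /node_lt hj; have := node_gt0 i; have := node_gt0 j.
by rewrite /reach; nia.
Qed.

Lemma reach_inj : injective reach.
Proof. by move=> t u /addrI [] /val_inj /enum_rank_inj. Qed.

(** Far abscissas and clique abscissas are told apart by their absolute value,
    as [node i < reach t]. *)
Lemma abscissa_point t : `|(point t).1| = reach t \/
  exists2 i, t = corner i & (point t).1 = node i.
Proof.
have r0 : 0 <= reach t by rewrite addr_ge0 // exprn_ge0 // ltW ?node_gt0.
case: t r0 => [[i j]|k] r0 /=; last by left; case: ifP; rewrite ?normrN ger0_norm.
case: eqP => [->|_]; first by right; exists j.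
by left; case: ifP => _ /=; rewrite ?normrN ger0_norm.
Qed.

Lemma abscissa_inj : injective (fst \o point).
Proof.
move=> t u /= tu; have := abscissa_point t; have := abscissa_point u.
rewrite tu => -[hu|[j -> hu]] [ht|[i -> ht]].
- by apply: reach_inj; rewrite -hu.
- have := node_lt_reach u (ltn_ord i).
  by rewrite -hu ht ger0_norm ?ltxx // ltW ?node_gt0.
- have := node_lt_reach t (ltn_ord j).
  by rewrite -ht hu ger0_norm ?ltxx // ltW ?node_gt0.
- by congr corner; apply/val_inj/node_inj; rewrite -hu.
Qed.

(** * Sides of the secant through two clique points *)

Section Side.
Variables a b : 'I_m.
Hypothesis ab : (a < b)%N.

Definition side t : int := sgz (orient (point (corner a)) (point (corner b)) (point t)).

Let nab : node a < node b.
Proof. by have := node_lt ab; have := node_gt0 a; lia. Qed.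

Lemma side_far right s t : point t = far_point right s (reach t) ->
  s != node a + node b ->
  side t = if right then sgz (s - (node a + node b))
           else - sgz (s - (node a + node b)).
Proof.
move=> pt sab; rewrite /side !point_corner pt sgz_orient_far ?node_gt0 //.
exact: mul_node_lt_reach.
Qed.

Lemma side_corner i : side (corner i) =
  if (i == a) || (i == b) then 0 else if (a < i < b)%N then -1 else 1.
Proof.
rewrite /side !point_corner sgz_orient_parabola //.
have [->|ia] := eqVneq i a; first by rewrite subrr sgz0 mul0r.
have [->|ib] := eqVneq i b; first by rewrite subrr sgz0 mulr0.
have hn := node_gt0; have hl := node_lt.
have [hia|hia|/val_inj/eqP] := ltngtP i a; last by rewrite (negbTE ia).
- rewrite !ltr0_sgz //; have := hl _ _ hia; have := hn i; lia.
- rewrite (gtr0_sgz (_ : 0 < node i - node a)); last first.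
    by have := hl _ _ hia; have := hn a; lia.
  have [hib|hib|/val_inj/eqP] := ltngtP i b; last by rewrite (negbTE ib).
  + by rewrite ltr0_sgz //; have := hl _ _ hib; have := hn i; lia.
  + by rewrite gtr0_sgz //; have := hl _ _ hib; have := hn b; lia.
Qed.

(** The odd slope [node i + node j - 1] fits just below that of the secant
    (i, j), so the point is above the secants that come strictly earlier. *)
Lemma side_right (i j : 'I_m) : (i < j)%N ->
  side (inl (i, j)) = if (b < j)%N || (j == b) && (a < i)%N then 1 else -1.
Proof.
move=> ij; have hn := node_gt0; have hl := node_lt; have he := node_even.
rewrite (@side_far true (node i + node j - 1)); first last.
- by rewrite !he; lia.
- by rewrite /= -val_eqE /= ltn_eqF // ij.
have hij := hl _ _ ij; have hab := hl _ _ ab.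
have := (hn i, hn j, hn a, hn b) => -[[[i0 j0] a0] b0].
have [hbj|hjb|hjb] := ltngtP b j => /=.
- by rewrite gtr0_sgz //; have := hl _ _ hbj; lia.
- by rewrite -val_eqE /= ltn_eqF //= ltr0_sgz //; have := hl _ _ hjb; lia.
- rewrite -(val_inj hjb) eqxx /=; case: ltnP => hai.
    by rewrite gtr0_sgz //; have := hl _ _ hai; have := he a; lia.
  rewrite ltr0_sgz //; move: hai; rewrite leq_eqVlt => /orP[/eqP ->|/hl]; lia.
Qed.

(** [node j] separates the slopes of the secants with larger index less than j
    from the others; being on the left reverses the comparison. *)
Lemma side_left (i j : 'I_m) : (i < j)%N ->
  side (inl (j, i)) = if (j <= b)%N then 1 else -1.
Proof.
move=> ij; have hn := node_gt0; have hl := node_lt.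
have hab := hl _ _ ab; have := (hn j, hn a, hn b) => -[[j0 a0] b0].
rewrite (@side_far false (node j)) /=; first last.
- have [/hl|/hl|->] := ltngtP b j; lia.
- by rewrite -val_eqE /= gtn_eqF // ltnNge (ltnW ij).
case: (leqP j b) => [|/hl] hjb.
  rewrite ltr0_sgz ?opprK //; move: hjb; rewrite leq_eqVlt => /orP[/eqP ->|/hl]; lia.
by rewrite gtr0_sgz //; lia.
Qed.

Lemma side_ballast k : side (inr k) = if (k < B)%N then -1 else 1.
Proof.
have := (node_gt0 a, node_gt0 b) => -[a0 b0].
rewrite (@side_far (k < B)%N 0) //; last by lia.
by rewrite ltr0_sgz ?opprK //; lia.
Qed.

Lemma side_pair (i j : 'I_m) : (i < j)%N ->
  side (inl (i, j)) + side (inl (j, i)) =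
  if (j == b) && (a < i)%N then 2 else 0.
Proof.
move=> ij; rewrite side_right // side_left // -val_eqE /=.
by case: (ltngtP b j) => //= hbj; case: ifP.
Qed.

(** For i strictly between a and b, the -1 of the clique point is overcome by the
    +2 of the pair (i, b), so that it counts like a point outside [a, b]. *)
Lemma sum_side_corner (i : 'I_m) :
  side (corner i) + \sum_(j < m | (i < j)%N)
    (side (inl (i, j)) + side (inl (j, i))) =
  if (i == a) || (i == b) then 0 else 1.
Proof.
have -> : \sum_(j < m | (i < j)%N) (side (inl (i, j)) + side (inl (j, i))) =
    if (a < i < b)%N then 2 else 0.
  rewrite (eq_bigr (fun j => if (j == b) && (a < i)%N then 2 else 0)); last first.
    by move=> j ij; apply: side_pair.
  case: (ltnP a i) => hai /=; last first.
    by rewrite big1 // => j _; rewrite andbF.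
  rewrite -big_mkcondr /=.
  under eq_bigl => j do rewrite andbT andbC.
  rewrite big_mkcondr /= big_pred1_eq //.
rewrite side_corner -!val_eqE /=; have := ab.
by case: (ltngtP i a); case: (ltngtP i b) => //=; lia.
Qed.

Lemma sum_side_ballast : (B <= r)%N -> \sum_k side (inr k) = r%:Z - 2 * B%:Z.
Proof.
move=> Br; under eq_bigr do rewrite side_ballast.
rewrite -(big_mkord xpredT (fun k => if (k < B)%N then -1 else 1 : int)).
rewrite (big_cat_nat _ Br) //=.
rewrite big_nat (eq_bigr (fun=> -1)); last by move=> k /andP[_ ->].
rewrite [X in _ + X]big_nat [X in _ + X](eq_bigr (fun=> 1)); last first.
  by move=> k /andP[hk _]; rewrite ltnNge hk.
by rewrite -!big_nat !sumr_const_nat; lia.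
Qed.

(** The ballast contributes r - 2 B = 2 - m, against m - 2 for the rest. *)
Lemma sum_side : (r + m = 2 * B + 2)%N -> (B <= r)%N -> \sum_t side t = 0.
Proof.
move=> rm Br; rewrite big_sumType /= sum_side_ballast //.
rewrite (eq_bigr (fun p => side (inl (p.1, p.2)))); last by case.
rewrite -(pair_bigA _ (fun i j => side (inl (i, j)))) /= sum_diag_pairs.
under eq_bigr => i _ do rewrite sum_side_corner.
rewrite (eq_bigr (fun i => 1 - ((i == a)%:Z + (i == b)%:Z))); last first.
  move=> i _; have [->|] := eqVneq i a => /=; last by case: (i == b).
  by rewrite -val_eqE /= ltn_eqF.
have delta_sum c : \sum_(i < m) (i == c)%:Z = 1.
  by rewrite (bigD1 c) //= eqxx big1 ?addr0 // => i /negbTE ->.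
by rewrite sumrB big_split /= !delta_sum sumr_const card_ord; lia.
Qed.

Lemma side_neq0 t : t != corner a -> t != corner b -> side t != 0.
Proof.
case: t => [[i j]|k]; last by rewrite side_ballast; case: ifP.
have [ij|ij|/val_inj ->] := ltngtP i j.
- by rewrite side_right //; case: ifP.
- by rewrite side_left //; case: ifP.
rewrite -/(corner j) side_corner !(inj_eq corner_inj).
by move=> /negbTE -> /negbTE -> /=; case: ifP.
Qed.

End Side.

Lemma card_label : #|label| = (m * m + r)%N.
Proof. by rewrite card_sum card_prod !card_ord. Qed.

End Construction.

(** * The bound *)

(** With r = n - m^2 the ballast equation [sum_side] determines B; it has a
    solution in integers because n is even and m^2 - m is even, and B <= r is the
    hypothesis on m. *)
Lemma exists_clique_configuration (R : realType) (n m : nat) :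
  (0 < m)%N -> (0 < n)%N -> ~~ odd n -> (m * m + m <= n + 2)%N ->
  exists p : 'I_n -> 'rV[R]_2, configuration p /\
    exists K : {set 'I_n}, clique (underlying_graph p) K /\ #|K| = m.
Proof.
move=> m0 n0 nodd mn; pose r := (n - m * m)%N; pose B := ((r + m)./2 - 1)%N.
have mmn : (m * m <= n)%N by nia.
have rm : (r + m = 2 * B + 2)%N.
  have : ~~ odd (r + m) by rewrite oddD oddB // oddM andbb (negbTE nodd) addbb.
  by have := subnK mmn; rewrite /B -/r; nia.
have Br : (B <= r)%N by have := subnK mmn; rewrite -/r; lia.
have nE : #|label m r| = n by rewrite card_label /r subnKC.
have nodes (x y : 'I_m) :
    (point B (corner r x)).1 < (point B (corner r y)).1 -> (x < y)%N.
  rewrite !point_corner /= => hxy; rewrite ltnNge; apply/negP.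
  rewrite leq_eqVlt => /orP[/eqP/val_inj yx|/node_lt]; first by rewrite yx ltxx in hxy.
  by have := node_gt0 y; lia.
have [||p [pc [K [Kc cardK]]]] := @clique_of_balanced_orientations R (label m r)
  (point B) [set corner r i | i in 'I_m] (@abscissa_inj m r B).
- move=> _ _ t /imsetP[a _ ->] /imsetP[b _ ->] /nodes ab ta tb.
  by rewrite -sgz_eq0; apply: side_neq0.
- by move=> _ _ /imsetP[a _ ->] /imsetP[b _ ->] /nodes ab; apply: sum_side.
rewrite nE in p pc K Kc cardK *.
by exists p; split=> //; exists K; rewrite cardK card_imset ?card_ord //; apply: corner_inj.
Qed.

Theorem theorem5p9 (R : realType) :
  exists c : R, 0 < c /\
    forall n : nat, (0 < n)%N -> ~~ odd n ->
      exists p : 'I_n -> 'rV[R]_2,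
        configuration p /\
        exists K : {set 'I_n},
          clique (underlying_graph p) K /\ c * Num.sqrt n%:R <= #|K|%:R.
Proof.
exists 2^-1; split=> [|n n0 nodd]; first by rewrite invr_gt0.
have ex1 : exists m, (m * m + m <= n + 2)%N by exists 1%N; lia.
have bound m : (m * m + m <= n + 2)%N -> (m <= n + 2)%N by lia.
have [m mn mmax] := ex_maxnP ex1 bound.
have m0 : (0 < m)%N by apply: mmax; lia.
have [p [pc [K [Kc cardK]]]] := exists_clique_configuration R m0 n0 nodd mn.
exists p; split=> //; exists K; split=> //; rewrite cardK.
(* By maximality n < m^2 + 3 m, which is at most 4 m^2. *)
have nm : (n <= (m * 2) ^ 2)%N.
  have [/mmax|] := leqP (m.+1 * m.+1 + m.+1) (n + 2); first by rewrite ltnn.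
  by nia.
rewrite mulrC ler_pdivrMr // -natrM -[leRHS]ger0_norm ?ler0n // -sqrtr_sqr.
by rewrite ler_sqrt ?exprn_ge0 // -natrX ler_nat.
Qed.
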